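(* Let $G$ be a finite simple graph and let $S$ be an odd dominating set of $G$. Then $|S| \equiv \rho(G) \pmod 2$. Equivalently, $|V(G)\setminus S| \equiv \nu(G) \pmod 2$.
   Context: For a vertex $u$ of a finite simple graph $G$, the closed neighborhood is $N[u]=\{v\in V(G) : v \text{ is adjacent to } u \text{ or } v=u\}$. A set $S\subseteq V(G)$ is an odd dominating set if $|N[u]\cap S|$ is odd for every $u\in V(G)$. With $V(G)=\{v_1,\dots,v_n\}$, the closed neighborhood matrix $N(G)$ is the $n\times n$ matrix over the field $\mathbb{Z}_2$ whose $i$-th column is the characteristic vector of $N[v_i]$ (i.e. the adjacency matrix plus the identity, over $\mathbb{Z}_2$). The rank $\rho(G)$ is the dimension of the column space of $N(G)$ over $\mathbb{Z}_2$, and the nullity $\nu(G)$ is the dimension of its kernel over $\mathbb{Z}_2$; thus $\rho(G)+\nu(G)=n$. *)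

(* Defs.v *)
From mathcomp Require Import all_boot all_order all_algebra.

Set Implicit Arguments.
Unset Strict Implicit.
Unset Printing Implicit Defensive.

(* A finite simple graph is a finType of vertices with a symmetric and
   irreflexive adjacency relation; both properties are assumed where they are
   needed, not here. *)

Definition closed_nbhd (V : finType) (adj : rel V) (u : V) : {set V} :=
  [set v | adj v u || (v == u)].

Definition odd_dominating (V : finType) (adj : rel V) (S : {set V}) : Prop :=
  forall u : V, odd #|closed_nbhd adj u :&: S|.

Local Open Scope ring_scope.

(* Vertices are numbered by enum_val; rank and nullity do not depend on the
   numbering. *)
Definition closed_nbhd_mx (V : finType) (adj : rel V) : 'M['F_2]_#|V| :=
  \matrix_(i, j) (enum_val i \in closed_nbhd adj (enum_val j))%:R.

(* \rank and kermx are about row spaces and left kernels, hence the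
   transpositions: the row space of N^T is the column space of N, and
   u *m N^T = 0 means N *m u^T = 0. *)
Definition graph_rank (V : finType) (adj : rel V) : nat :=
  \rank (closed_nbhd_mx adj)^T.

Definition graph_nullity (V : finType) (adj : rel V) : nat :=
  \rank (kermx (closed_nbhd_mx adj)^T).

(* Main.v *)
Require Import Defs.
From mathcomp Require Import all_boot all_order all_algebra.
From mathcomp Require Import ring.

(** If [N] is symmetric over F_2 and [x N] is the diagonal of [N], then
    [B = N - (x N)^T (x N)] is symmetric with zero diagonal, hence has even rank,
    while [rank N - rank B] is [1] or [0] according to whether [x N x^T] is [1]
    or [0]. For a closed neighborhood matrix the diagonal is the all-ones vector,
    the equation on [x] says that [x] is the indicator of an odd dominating set
    [S], and then [x N x^T = |S|]. *)

Set Implicit Arguments.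
Unset Strict Implicit.
Unset Printing Implicit Defensive.

Import GRing.Theory.
Local Open Scope ring_scope.

Lemma mulmx_scalar11 (R : comNzRingType) (m n : nat)
    (u : 'M[R]_(m, 1)) (a : 'M[R]_1) (v : 'M[R]_(1, n)) :
  u *m a *m v = a 0 0 *: (u *m v).
Proof. by rewrite {1}(mx11_scalar a) mul_mx_scalar scalemxAl. Qed.

(* Wedderburn's rank reduction. *)
Lemma mxrank_sub_rank1 (F : fieldType) (m n : nat) (A : 'M[F]_(m, n))
    (u : 'rV[F]_m) (v : 'cV[F]_n) (c : F) :
  (u *m A *m v) 0 0 = c -> c != 0 ->
  \rank A = (\rank (A - c^-1 *: (A *m v *m (u *m A)))).+1.
Proof.
move=> cE c0; set B := A - _.
have Bv : B *m v = 0.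
  rewrite mulmxBl -scalemxAl -(mulmxA (A *m v)) [u *m A *m v]mx11_scalar cE.
  by rewrite mul_mx_scalar scalerA mulVf // scale1r subrr.
have uA0 : u *m A != 0.
  by apply: contraNneq c0 => uA; rewrite -cE uA mul0mx mxE.
have sBA : (B <= A)%MS.
  by rewrite addmx_sub // eqmx_opp scalemx_sub // mulmxA submxMl.
have sAB : (A <= B + u *m A)%MS.
  rewrite -[X in (X <= _)%MS](subrK (c^-1 *: (A *m v *m (u *m A)))).
  by rewrite addmx_sub_adds // scalemx_sub // submxMl.
have eqA : (A :=: B + u *m A)%MS.
  by apply/eqmxP; rewrite sAB addsmx_sub sBA submxMl.
(* A common vector [a *m (u *m A)] is killed by [v], being in the row space of [B]; but
   [u *m A *m v] is [c], which is nonzero, so [a = 0]. *)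
have capB : (B :&: u *m A)%MS = 0.
  apply/eqP; rewrite -submx0; apply/rV_subP => w.
  rewrite sub_capmx => /andP[/submxP[y ->] /submxP[a yB]].
  have : a *m (u *m A *m v) = 0 by rewrite mulmxA -yB -mulmxA Bv mulmx0.
  rewrite [u *m A *m v]mx11_scalar cE mul_mx_scalar => /eqP.
  by rewrite scaler_eq0 (negPf c0) /= yB => /eqP->; rewrite mul0mx sub0mx.
by rewrite eqA mxrank_disjoint_sum // rank_rV uA0 addn1.
Qed.

(* Each single reduction destroys skew-symmetry; two of them, with the roles of
   [u] and [v] exchanged, restore it and lower the rank by 2. *)
Lemma odd_mxrank_alternating (F : fieldType) (n : nat) (A : 'M[F]_n) :
  A^T = - A -> (forall i, A i i = 0) -> ~~ odd (\rank A).
Proof.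
have [r] := ubnP (\rank A); elim: r A => // r IHr A ltAr skewA diagA.
have skew k l : A l k = - A k l by move/matrixP: skewA => /(_ k l); rewrite !mxE.
have [-> | /matrix0Pn [i [j c0]]] := eqVneq A 0; first by rewrite mxrank0.
pose u : 'rV[F]_n := delta_mx 0 i; pose v : 'rV[F]_n := delta_mx 0 j.
set c := A i j in c0.
have uA : u *m A = row i A by rewrite rowE.
have vA : v *m A = row j A by rewrite rowE.
have Au : A *m u^T = col i A by rewrite trmx_delta colE.
have Av : A *m v^T = col j A by rewrite trmx_delta colE.
have uAv : (u *m A *m v^T) 0 0 = c by rewrite uA trmx_delta -colE !mxE.
have := mxrank_sub_rank1 uAv c0.
rewrite uA Av; set A1 := A - _ => rkA.
have A1E k l : A1 k l = A k l - c^-1 * (A k j * A i l).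
  by rewrite !mxE big_ord1 !mxE.
(* As [A j j = A i i = 0], the first reduction leaves row [j] and column [i] intact, so the second
   pivot is [A j i = - c]. *)
have vA1 : v *m A1 = row j A.
  apply/rowP => l; rewrite -rowE [LHS]mxE A1E diagA mxE; ring.
have A1u : A1 *m u^T = col i A.
  apply/colP => k; rewrite trmx_delta -colE [LHS]mxE A1E diagA mxE; ring.
have vA1u : (v *m A1 *m u^T) 0 0 = - c.
  by rewrite vA1 trmx_delta -colE !mxE skew.
have := mxrank_sub_rank1 vA1u; rewrite oppr_eq0 => /(_ c0).
rewrite vA1 A1u; set A2 := A1 - _ => rkA1.
(* By skewness, swapping [k] and [l] turns each correction term into minus the other, and the two
   cancel when [k = l]. *)
have A2E k l : A2 k l =
    A k l - c^-1 * (A k j * A i l) + c^-1 * (A k i * A j l).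
  rewrite [LHS]mxE A1E !mxE big_ord1 !mxE invrN; ring.
rewrite rkA rkA1 /= negbK; apply: IHr.
- by move: ltAr; rewrite rkA rkA1 => /ltnW; rewrite ltnS.
- apply/matrixP => k l; rewrite [LHS]mxE [RHS]mxE !A2E.
  rewrite (skew k l) (skew j l) (skew i l) (skew k i) (skew k j); ring.
- move=> k; rewrite A2E diagA (skew k i) (skew k j); ring.
Qed.

Lemma natr_F2_odd (n : nat) : n%:R = (odd n)%:R :> 'F_2.
Proof. by rewrite -[LHS]Zp_nat_mod // modn2. Qed.

Lemma F2_cases (a : 'F_2) : (a = 0) + (a = 1).
Proof.
by case: a => [[|[|//]] lta]; [left | right]; apply: val_inj.
Qed.

Lemma mxrank_sym_F2 (n : nat) (A : 'M['F_2]_n) (x : 'rV['F_2]_n) :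
  A^T = A -> x *m A = \row_i A i i ->
  (\rank A)%:R = (x *m A *m x^T) 0 0 :> 'F_2.
Proof.
move=> symA xA; set q := (_ *m _) 0 0.
have AxT : A *m x^T = (x *m A)^T by rewrite trmx_mul symA.
pose B := A - A *m x^T *m (x *m A).
have opp2 (a : 'F_2) : - a = a.
  by case: (F2_cases a) => ->; apply: val_inj.
have evenB : ~~ odd (\rank B).
  apply: odd_mxrank_alternating => [|i].
    have -> : - B = B by apply/matrixP => i j; rewrite mxE opp2.
    by rewrite /B linearB /= symA trmx_mul AxT trmxK.
  (* The diagonal entry is [a - a * a] with [a = A i i], which vanishes for both elements of F_2. *)
  rewrite /B AxT xA !mxE big_ord1 !mxE.
  by case: (F2_cases (A i i)) => ->; apply: val_inj.
have [q0 | q1] := F2_cases q.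
(* [B] factors as [A *m T]. When [q = 0], [x^T *m (x *m A)] squares to zero, so [T] is invertible
   and [B] has the rank of [A]. *)
- pose T : 'M_n := 1%:M - x^T *m (x *m A).
  have unitT : T \in unitmx.
    have sq0 : x^T *m (x *m A) *m (x^T *m (x *m A)) = 0.
      rewrite mulmxA -[x^T *m _ *m x^T]mulmxA mulmx_scalar11.
      by rewrite -/q q0 scale0r.
    case: (mulmx1_unit (A := T) (B := 1%:M + x^T *m (x *m A))) => //.
    by rewrite mulmxDr mulmx1 mulmxBl mul1mx sq0 subr0 subrK.
  have BE : B = A *m T by rewrite /T mulmxBr mulmx1 (mulmxA A).
  rewrite q0 natr_F2_odd -(mxrankMfree A (B := T)) ?row_free_unit //.
  by rewrite -BE (negPf evenB).
(* When [q = 1], [B] is the Wedderburn reduction of [A] along [x] and [x^T]. *)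
- have := mxrank_sub_rank1 q1 (oner_neq0 _); rewrite invr1 scale1r => ->.
  by rewrite natr_F2_odd /= evenB.
Qed.

Theorem theorem2p4 (V : finType) (adj : rel V)
    (adj_sym : symmetric adj) (adj_irr : irreflexive adj)
    (S : {set V}) (S_odd : odd_dominating adj S) :
  #|S| = graph_rank adj %[mod 2] /\
  #|[set: V] :\: S| = graph_nullity adj %[mod 2].
Proof.
pose N := closed_nbhd_mx adj.
pose x : 'rV['F_2]_#|V| := \row_i (enum_val i \in S)%:R.
have symN : N^T = N.
  by apply/matrixP => i j; rewrite !mxE !inE adj_sym eq_sym.
have cardE (P : {set V}) :
    \sum_(i < #|V|) (enum_val i \in P)%:R = #|P|%:R :> 'F_2.
  rewrite -(big_enum_val (A := V) (fun v => (v \in P)%:R)) /= -natr_sum.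
  by rewrite -sum1_card [in RHS]big_mkcond.
have xN : x *m N = const_mx 1.
  apply/rowP => j; rewrite !mxE.
  (* Entry [j] of [x *m N] counts, mod 2, the members of [S] in the closed neighborhood of vertex
     [j]. *)
  transitivity (#|closed_nbhd adj (enum_val j) :&: S|%:R : 'F_2).
    rewrite -cardE; apply: eq_bigr => i _.
    by rewrite !mxE -natrM mulnb andbC -in_setI.
  by rewrite natr_F2_odd S_odd.
have diagN : \row_i N i i = const_mx 1.
  by apply/rowP => i; rewrite !mxE inE eqxx orbT.
have rkE : (\rank N)%:R = #|S|%:R :> 'F_2.
  rewrite (mxrank_sym_F2 (x := x)) ?xN ?diagN // mxE -cardE.
  by apply: eq_bigr => i _; rewrite !mxE mul1r.
have oddE : odd #|S| = odd (\rank N).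
  move: rkE; rewrite natr_F2_odd [RHS]natr_F2_odd.
  by case: (odd _); case: (odd _).
(* By rank-nullity, the second congruence is the first one subtracted from [#|V|]. *)
rewrite /graph_rank /graph_nullity mxrank_ker -/N symN !modn2 oddE; split=> //.
by rewrite setTD cardsCs setCK !oddB ?max_card ?rank_leq_row // oddE.
Qed.
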